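(* Let $n\ge 2$. There is a full $(n+2)$-coloring $\Gamma$ of $\mathbb{S}^n$ such that every $(n-1)$-sphere $S\subset\mathbb{S}^n$ is colored using at most $n+1$ colors, i.e. $|\Gamma(S)|\le n+1$.
   Context: The standard $n$-sphere is $\mathbb{S}^n = \{(x_0,\dots,x_n)\in\mathbb{R}^{n+1} : \sum_{i=0}^n x_i^2 = 1\}$. A full $k$-coloring of $\mathbb{S}^n$ is a surjective map $\Gamma:\mathbb{S}^n\to\{1,\dots,k\}$; no regularity is assumed. An $(n-1)$-sphere in $\mathbb{S}^n$ is a set of the form $P\cap\mathbb{S}^n$, where $P$ is an affine hyperplane of $\mathbb{R}^{n+1}$ (not necessarily through the origin) that meets the open ball bounded by $\mathbb{S}^n$. *)

(* Defs.v *)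
From mathcomp Require Import all_boot all_order all_algebra.
From mathcomp Require Import boolp classical_sets functions cardinality reals.

Set Implicit Arguments.
Unset Strict Implicit.
Unset Printing Implicit Defensive.

Import Order.TTheory GRing.Theory Num.Theory.
Local Open Scope classical_set_scope.
Local Open Scope ring_scope.

Section Spheres.
Variables (R : realType) (n : nat).

(* Points of R^(n+1) are row vectors with coordinates x 0 0, ..., x 0 n.  The
   Euclidean norm is written out, because the norm that MathComp-Analysis puts
   on matrices is the max norm. *)
Definition sqnorm (x : 'rV[R]_n.+1) : R := \sum_i x 0 i ^+ 2.

Definition sphere : set 'rV[R]_n.+1 := [set x | sqnorm x = 1].

Definition open_unit_ball : set 'rV[R]_n.+1 := [set x | sqnorm x < 1].

Definition affine_hyperplane (P : set 'rV[R]_n.+1) : Prop :=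
  exists (a : 'rV[R]_n.+1) (b : R),
    a != 0 /\ P = [set x | \sum_i a 0 i * x 0 i = b].

(* The (n-1)-spheres in the n-sphere, as subsets of the type of its points. *)
Definition codim1_sphere (S : set sphere) : Prop :=
  exists P : set 'rV[R]_n.+1,
    [/\ affine_hyperplane P, P `&` open_unit_ball !=set0
      & S = [set x : sphere | P (val x)]].

(* The k colors are the elements of 'I_k. *)
Definition full_coloring (k : nat) (Gamma : sphere -> 'I_k) : Prop :=
  set_surj [set: sphere] [set: 'I_k] Gamma.

End Spheres.

Arguments sphere R n : clear implicits.

(* Main.v *)
Require Import Defs.
From mathcomp Require Import all_boot all_order all_algebra.
From mathcomp Require Import boolp classical_sets functions cardinality reals.

(** The coloring follows a complete flag of great spheres
    S^0 < S^1 < ... < S^n, where S^k consists of the points whose coordinates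
    of index above k vanish: the two points e_0 and - e_0 of S^0 get a color
    each, and every difference S^k \ S^(k-1) with 0 < k gets one color, which
    makes n + 2 colors.

    A choice of one point of each color is affinely independent, because each
    new point leaves the linear span of the previous ones and the first two
    points are opposite.  Such n + 2 points lie in no hyperplane of R^(n+1),
    so no hyperplane section of the sphere meets all the colors
    ([eq0_of_all_colors]); it uses at most the n + 1 others. *)

Import Order.TTheory GRing.Theory Num.Theory.
Local Open Scope classical_set_scope.
Local Open Scope ring_scope.

Section LastNonzeroCoordinate.
Context {R : realType} {n : nat}.
Implicit Types (x a : 'rV[R]_n.+1) (i j : 'I_n.+1).

Definition last_index x : 'I_n.+1 := inord (\max_(i < n.+1 | x 0 i != 0) i).

Lemma last_indexE x : last_index x = \max_(i < n.+1 | x 0 i != 0) i :> nat.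
Proof. by rewrite inordK // ltnS; apply/bigmax_leqP => i _; rewrite -ltnS. Qed.

Lemma last_index_neq0 x : x != 0 -> x 0 (last_index x) != 0.
Proof.
move=> /rV0Pn[i xi].
have : (0 < #|[pred i | (x 0 i != 0)%R]|)%N by apply/card_gt0P; exists i.
move=> /(eq_bigmax_cond (fun i : 'I_n.+1 => i : nat))[j xj maxE].
suff -> : last_index x = j by [].
by apply: val_inj; rewrite /= last_indexE -maxE.
Qed.

Lemma last_index_gt x j : (last_index x < j)%N -> x 0 j = 0.
Proof.
rewrite last_indexE => lt_j; apply/eqP/negPn/negP => xj.
by move: lt_j; rewrite ltnNge (leq_bigmax_cond j).
Qed.

Lemma last_index_eq x i :
  x 0 i != 0 -> (forall j, (i < j)%N -> x 0 j = 0) -> last_index x = i.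
Proof.
move=> xi x_gt; apply/val_inj/eqP; rewrite /= last_indexE eqn_leq.
rewrite (leq_bigmax_cond i) // andbT.
apply/bigmax_leqP => j; apply: contraR; rewrite -ltnNge => /x_gt ->.
by rewrite eqxx.
Qed.

Definition flag_color x : 'I_n.+2 :=
  if (last_index x == ord0) && (x 0 ord0 < 0) then ord0
  else lift ord0 (last_index x).

Lemma flag_color_lift x i : flag_color x = lift ord0 i -> last_index x = i.
Proof.
rewrite /flag_color; case: ifP => _; last exact: lift_inj.
by move=> /eqP; rewrite (negPf (neq_lift _ _)).
Qed.

Lemma dot_last_index a x i :
  (forall j, (j < i)%N -> a 0 j = 0) -> last_index x = i ->
  \sum_j a 0 j * x 0 j = a 0 i * x 0 i.
Proof.
move=> a_lt xi; rewrite (bigD1 i) //= big1 ?addr0 // => j.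
rewrite neq_ltn => /orP[/a_lt ->|lt_ij]; first by rewrite mul0r.
by rewrite (@last_index_gt x) ?mulr0 // xi.
Qed.

(** The nonzero points of colors 0 and 1 are multiples of e_0 of opposite
    signs; on the unit sphere they are opposite, which forces b = 0 and
    a_0 = 0.  Each further color k + 1 then contributes a triangular equation
    a_k x_k = 0 with x_k nonzero, hence a_k = 0. *)
Lemma eq0_of_all_colors a (b : R) :
  (forall c, exists x,
     [/\ sqnorm x = 1, flag_color x = c & \sum_j a 0 j * x 0 j = b]) ->
  a = 0.
Proof.
move=> hit.
have nz x : sqnorm x = 1 -> x != 0.
  move=> x1; apply/eqP => x0; move/eqP: x1.
  rewrite /sqnorm x0 big1 ?(eq_sym 0) ?oner_eq0 // => i _.
  by rewrite mxE expr0n.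
have dot0 x : last_index x = ord0 -> \sum_j a 0 j * x 0 j = a 0 ord0 * x 0 ord0.
  exact: dot_last_index.
have sq0 x : sqnorm x = 1 -> last_index x = ord0 -> x 0 ord0 ^+ 2 = 1.
  move=> <- x0; rewrite /sqnorm (bigD1 ord0) //= big1 ?addr0 // => j j0.
  by rewrite (@last_index_gt x) ?expr0n // x0 lt0n.
have [p [p1 pc pb]] := hit ord0; have [q [q1 qc qb]] := hit (lift ord0 ord0).
have /andP[/eqP p0 p_lt0] : (last_index p == ord0) && (p 0 ord0 < 0).
  by move: pc; rewrite /flag_color; case: ifP.
have q0 := flag_color_lift _ _ qc.
have q_ge0 : 0 <= q 0 ord0.
  by move: qc; rewrite /flag_color q0 eqxx /=; case: ltP.
have pE : p 0 ord0 = -1.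
  have /eqP := sq0 _ p1 p0; rewrite sqrf_eq1 => /orP[]/eqP // pE.
  by move: p_lt0; rewrite pE ltr10.
have qE : q 0 ord0 = 1.
  have /eqP := sq0 _ q1 q0; rewrite sqrf_eq1 => /orP[]/eqP // qE.
  by move: q_ge0; rewrite qE oppr_ge0 ler10.
have ab : a 0 ord0 = b by rewrite -qb dot0 // qE mulr1.
have b0 : b = 0.
  by apply/eqP; rewrite -eqNr -{2}pb dot0 // pE mulrN1 ab.
apply/rowP => i; rewrite mxE.
have [m] := ubnP (i : nat); elim: m i => // m IHm i lt_im.
have [x [/nz x0 /flag_color_lift xi xb]] := hit (lift ord0 i).
have a_lt j : (j < i)%N -> a 0 j = 0.
  by move=> lt_ji; apply: IHm; apply: leq_trans lt_ji _.
move/eqP: xb; rewrite (dot_last_index _ _ _ a_lt xi) b0 mulf_eq0.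
case/orP=> [/eqP //|]; rewrite -[X in x 0 X]xi.
by rewrite (negPf (last_index_neq0 _ x0)).
Qed.

Lemma flag_color_surj (c : 'I_n.+2) :
  exists x : 'rV[R]_n.+1, sqnorm x = 1 /\ flag_color x = c.
Proof.
pose e s i : 'rV[R]_n.+1 := s *: delta_mx 0 i.
have eE s i j : e s i 0 j = s * (j == i)%:R by rewrite !mxE eqxx.
have e1 s i : s ^+ 2 = 1 -> sqnorm (e s i) = 1.
  move=> s1; rewrite /sqnorm (bigD1 i) //= eE eqxx mulr1 s1 big1 ?addr0 // => j.
  by rewrite eE => /negPf ->; rewrite mulr0 expr0n.
have e_last s i : s != 0 -> last_index (e s i) = i.
  move=> s0; apply: last_index_eq; first by rewrite eE eqxx mulr1.
  by move=> j lt_ij; rewrite eE -val_eqE /= gtn_eqF ?mulr0.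
have [i ->|->] := unliftP ord0 c.
  exists (e 1 i); split; first by rewrite e1 ?expr1n.
  rewrite /flag_color e_last ?oner_eq0 // eE mul1r.
  by rewrite ltNge ler0n andbF.
exists (e (-1) ord0); split; first by rewrite e1 ?sqrrN ?expr1n.
rewrite /flag_color e_last ?oppr_eq0 ?oner_eq0 // eE eqxx mulr1.
by rewrite ltrN10.
Qed.

End LastNonzeroCoordinate.

Lemma card_le_of_missed (m : nat) (A : set 'I_m.+2) (c : 'I_m.+2) :
  ~ A c -> (A #<= `I_m.+1)%card.
Proof.
move=> Ac.
have sub : A `<=` (fun k => lift c (inord k : 'I_m.+1)) @` `I_m.+1.
  move=> d Ad; have [k dE|dE] := unliftP c d; last by rewrite dE in Ad.
  by exists (k : nat); [exact: ltn_ord | rewrite inord_val].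
exact: card_le_trans (subset_card_le sub) (card_image_le _ _).
Qed.

Theorem proposition4p1 (R : realType) (n : nat) (hn : (2 <= n)%N) :
  exists Gamma : sphere R n -> 'I_n.+2,
    full_coloring Gamma /\
    forall S : set (sphere R n), codim1_sphere S ->
      (Gamma @` S #<= `I_n.+1)%card.
Proof.
exists (fun x => flag_color (val x)); split.
  move=> c _; have [x [x1 xc]] := flag_color_surj (R := R) c.
  by exists (exist _ x (mem_set x1)).
move=> S [P [[a [b [a0 PE]]] _ SE]].
have /existsNP[c Sc] : ~ forall c, ((fun x => flag_color (val x)) @` S) c.
  move=> hit; move/eqP: a0; apply; apply: (@eq0_of_all_colors R n a b) => c.
  have [x Sx xc] := hit c; exists (val x); split=> //.
    exact: set_mem (valP x).
  by move: Sx; rewrite SE PE.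
exact: card_le_of_missed Sc.
Qed.
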